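(* Let $(x_t)_{t\in\mathbb{Z}}$ be a real-valued stationary time series and fix a weight $\lambda>0$. Assume: (A1) (Existence) $(x_t)$ admits a weak innovations representation, i.e. there exist causal maps $G,H$ (acting on the infinite past) such that $\nu_t=G(x_t,x_{t-1},\dots)$, $\hat x_t=H(\nu_t,\nu_{t-1},\dots)$, the $\nu_t$ are i.i.d. $\mathcal U[0,1]$, and $(\hat x_t)\stackrel{d}{=}(x_t)$ (equality of all finite-dimensional joint distributions); moreover $H$ is continuous. (A2) (Feasibility) There exist parameters $\tilde\theta_m,\tilde\eta_m$ such that the finite-dimensional maps $G_{\tilde\theta_m},H_{\tilde\eta_m}$ converge uniformly to $G,H$ as $m\to\infty$. (A3) (Training) The training sample sizes are infinite, and for every $m,n$ the training algorithm converges almost surely to a global minimizer $(\theta_m^*,\eta_m^* )$ of the loss $L^{(n)}_m$ defined below. Then for every $n\in\mathbb{Z}^+$, the $m$-dimensional WIAE $(G_{\theta_m^*},H_{\eta_m^*})$ trained with $n$-dimensional discriminators converges in distribution of finite block $n$ to $(G,H)$: for all $t$, as $m\to\infty$, $$\boldsymbol\nu^{*(n)}_{t,m}\stackrel{d}{\to}\boldsymbol\nu^{(n)}_t \quad\text{and}\quad \hat{\boldsymbol x}^{*(n)}_{t,m}\stackrel{d}{\to}\boldsymbol x^{(n)}_t,$$ where $\boldsymbol\nu^{(n)}_t=(\nu_t,\dots,\nu_{t-n+1})$ (a vector of $n$ i.i.d. $\mathcal U[0,1]$ variables) and $\boldsymbol x^{(n)}_t=(x_t,\dots,x_{t-n+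1})$.
   Context: Finite-dimensional Weak Innovations AutoEncoder (WIAE): for each input dimension $m$, $G_\theta:\mathbb{R}^m\to\mathbb{R}$ and $H_\eta:\mathbb{R}^m\to\mathbb{R}$ are parameterized (neural-network) functions; they are regarded as functions of the whole past by ignoring all but the $m$ most recent coordinates (this is the sense of uniform convergence in (A2)). Given parameters $(\theta,\eta)$ define $\nu_{t,m}=G_\theta(x_t,\dots,x_{t-m+1})$ and $\hat x_{t,m}=H_\eta(\nu_{t,m},\dots,\nu_{t-m+1,m})$, and the $n$-blocks $\boldsymbol\nu^{(n)}_{t,m}=(\nu_{t,m},\dots,\nu_{t-n+1,m})$, $\hat{\boldsymbol x}^{(n)}_{t,m}=(\hat x_{t,m},\dots,\hat x_{t-n+1,m})$. The training loss with $n$-dimensional discriminators is $$L^{(n)}_m(\theta,\eta)=\max_{\gamma,\omega}\Big(\mathbb{E}[D_\gamma(\boldsymbol u^{(n)})]-\mathbb{E}[D_\gamma(\boldsymbol\nu^{(n)}_{t,m})]+\lambda\big(\mathbb{E}[D_\omega(\boldsymbol x^{(n)}_t)]-\mathbb{E}[D_\omega(\hat{\boldsymbol x}^{(n)}_{t,m})]\big)\Big),$$ where $\boldsymbol u^{(n)}$ is a vector of $n$ i.i.d. $\mathcal U[0,1]$ variables and the discriminators $D_\gamma,D_\omega:\mathbb{R}^n\to\mathbb{R}$ range over 1-Lipschitz functions, so that (by Kantorovich–Rubinstein duality) $L^{(n)}_m$ equals the 1-Wasserstein distance between the laws of $\boldsymbol u^{(n)}$ and $\boldsymbol\nu^{(n)}_{t,m}$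 plus $\lambda$ times the 1-Wasserstein distance between the laws of $\boldsymbol x^{(n)}_t$ and $\hat{\boldsymbol x}^{(n)}_{t,m}$. The starred quantities $\boldsymbol\nu^{*(n)}_{t,m},\hat{\boldsymbol x}^{*(n)}_{t,m}$ are these blocks computed with the optimal parameters $(\theta_m^*,\eta_m^* )$ minimizing $L^{(n)}_m$. *)

(* Defs.v *)
From HB Require Import structures.
From mathcomp Require Import all_boot all_order all_algebra.
From mathcomp Require Import all_classical all_reals all_analysis.
Import Order.TTheory GRing.Theory Num.Theory.
Import numFieldNormedType.Exports.

Set Implicit Arguments.
Unset Strict Implicit.
Unset Printing Implicit Defensive.

Local Open Scope classical_set_scope.
Local Open Scope ring_scope.

Section WIAE.
Variables (d : measure_display) (T : measurableType d) (R : realType).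
Variable (P : probability T R).

Definition borel_rV (k : nat) : set (set 'rV[R]_k) := <<s [set A | open A] >>.

Definition same_law (k : nat) (X Y : T -> 'rV[R]_k) : Prop :=
  forall A, borel_rV A -> P (X @^-1` A) = P (Y @^-1` A).

Definition fdvec (X : int -> T -> R) (k : nat) (idx : 'I_k -> int) : T -> 'rV[R]_k :=
  fun w => \row_(i < k) X (idx i) w.

Definition rv_process (X : int -> T -> R) : Prop :=
  forall t, measurable_fun setT (X t).

Definition stationary (X : int -> T -> R) : Prop :=
  rv_process X /\
  forall (k : nat) (idx : 'I_k -> int) (h : int),
    same_law (fdvec X (fun i => idx i + h)) (fdvec X idx).

Definition same_fdd (X Y : int -> T -> R) : Prop :=
  forall (k : nat) (idx : 'I_k -> int), same_law (fdvec X idx) (fdvec Y idx).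

Definition mutually_independent (I : eqType) (X : I -> T -> R) : Prop :=
  (forall i, measurable_fun setT (X i)) /\
  forall (s : seq I) (B : I -> set R),
    uniq s -> (forall i, measurable (B i)) ->
    P (\bigcap_(i in [set` s]) (X i @^-1` B i)) =
    (\prod_(i <- s) P (X i @^-1` B i))%E.

Definition uniform01 (Y : T -> R) : Prop :=
  forall B : set R, measurable B ->
    P (Y @^-1` B) = (@lebesgue_measure R) (B `&` `[0%R, 1%R]).

Definition iid_uniform (I : eqType) (X : I -> T -> R) : Prop :=
  mutually_independent X /\ forall i, uniform01 (X i).

(** Continuity of a map on R^N (the infinite past) for the product topology. *)
Definition continuous_seq (F : (nat -> R) -> R) : Prop :=
  forall (s : nat -> R) (e : R), 0 < e ->
    exists (K : nat) (del : R), 0 < del /\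
      forall s' : nat -> R, (forall k, (k < K)%N -> `|s k - s' k| < del) ->
        `|F s - F s'| < e.

Definition causal (F : (nat -> R) -> R) (X : int -> T -> R) : int -> T -> R :=
  fun t w => F (fun k : nat => X (t - k%:Z) w).

Definition weak_innovations (x : int -> T -> R) (G H : (nat -> R) -> R) : Prop :=
  let nu := causal G x in
  let xhat := causal H nu in
  iid_uniform nu /\ rv_process xhat /\ same_fdd xhat x /\ continuous_seq H.

Definition trunc (m : nat) (s : nat -> R) : 'rV[R]_m := \row_(i < m) s i.

Definition unif_conv (F : forall m : nat, 'rV[R]_m -> R) (F0 : (nat -> R) -> R) : Prop :=
  forall e : R, 0 < e -> exists M : nat, forall m : nat, (M <= m)%N ->
    forall s : nat -> R, `|F m (trunc m s) - F0 s| <= e.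

Definition nu_m (m : nat) (Gm : 'rV[R]_m -> R) (x : int -> T -> R) : int -> T -> R :=
  fun t w => Gm (\row_(i < m) x (t - i%:Z) w).

Definition xhat_m (m : nat) (Gm Hm : 'rV[R]_m -> R) (x : int -> T -> R) : int -> T -> R :=
  fun t w => Hm (\row_(i < m) nu_m Gm x (t - i%:Z) w).

Definition block (n : nat) (X : int -> T -> R) (t : int) : T -> 'rV[R]_n :=
  fun w => \row_(i < n) X (t - i%:Z) w.

Definition eucl (n : nat) (v : 'rV[R]_n) : R := Num.sqrt (\sum_(i < n) v ord0 i ^+ 2).

Definition lip1 (n : nat) (D : 'rV[R]_n -> R) : Prop :=
  forall a b, `|D a - D b| <= eucl (a - b).

Definition expect (n : nat) (D : 'rV[R]_n -> R) (X : T -> 'rV[R]_n) : \bar R :=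
  (\int[P]_w (D (X w))%:E)%E.

(** The training loss L^{(n)}_m(theta, eta) with n-dimensional 1-Lipschitz
    discriminators; [u] is a vector of n i.i.d. U[0,1] variables. *)
Definition loss (lam : R) (n m : nat) (u : T -> 'rV[R]_n) (x : int -> T -> R)
    (Gm Hm : 'rV[R]_m -> R) : \bar R :=
  ereal_sup [set (expect Dg u - expect Dg (block n (nu_m Gm x) 0)
                  + lam%:E * (expect Dw (block n x 0)
                              - expect Dw (block n (xhat_m Gm Hm x) 0)))%E
            | Dg in [set D | lip1 D] & Dw in [set D | lip1 D]].

Definition conv_dist (n : nat) (Xm : nat -> T -> 'rV[R]_n) (X : T -> 'rV[R]_n) : Prop :=
  forall f : 'rV[R]_n -> R, continuous f -> (exists C : R, forall v, `|f v| <= C) ->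
    (fun m => expect f (Xm m)) @ \oo --> expect f X.

Definition borel_fun (k : nat) (F : 'rV[R]_k -> R) : Prop :=
  forall A : set R, measurable A -> borel_rV (F @^-1` A).

Definition uvec (n : nat) (U : nat -> T -> R) : T -> 'rV[R]_n :=
  fun w => \row_(i < n) U i w.

End WIAE.

(* Main.v *)
Require Import Defs.
From HB Require Import structures.
From mathcomp Require Import all_boot all_order all_algebra.
From mathcomp Require Import all_classical all_reals all_analysis.
From mathcomp Require Import measurable_realfun lra.
Import Order.TTheory GRing.Theory Num.Theory.
Import numFieldNormedType.Exports.

Set Implicit Arguments.
Unset Strict Implicit.
Unset Printing Implicit Defensive.

Local Open Scope classical_set_scope.
Local Open Scope ring_scope.

(** By Kantorovich-Rubinstein duality the loss is W1(u, nu_m) + lam * W1(x, xhat_m),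
    where W1 is the 1-Wasserstein distance between the laws of the blocks at time 0.
    Almost surely the innovations path lies in the compact cube [0,1]^N, on which the
    continuous map [H] is bounded and around which it is uniformly continuous. Hence the
    blocks produced by the feasible networks of (A2) are uniformly close to the ideal
    ones, and since [u] and the blocks of [nu] have the same law, as do [x] and [H(nu)],
    the loss of the feasible networks tends to 0. By optimality so does the loss of the
    trained networks, and with it both Wasserstein distances. Convergence in W1 implies
    convergence in distribution because a bounded continuous test function is the
    increasing limit of its Lipschitz inf-convolutions. Stationarity moves the
    conclusion from time 0 to time [t]. *)

Section ereal_supD.
Local Open Scope ereal_scope.
Variable R : realType.
Implicit Types (x : \bar R) (A B : set (\bar R)).

(* No side condition is needed because +oo + -oo = -oo. *)
Lemma ereal_supDl x A :
  ereal_sup [set x + y | y in A] = x + ereal_sup A.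
Proof.
apply/eqP; rewrite eq_le; apply/andP; split.
  by apply/ereal_supP => _ [y Ay <-]; rewrite leeD2l// ereal_sup_ubound.
have ubA y : A y -> x + y <= ereal_sup [set x + z | z in A].
  by move=> Ay; apply: ereal_sup_ubound; exists y.
have [->|supA] := eqVneq (ereal_sup A) -oo; first by rewrite addeNy leNye.
have [y Ay yNy] : exists2 y, A y & -oo < y by apply/ereal_sup_gtP; rewrite ltNye.
case: x ubA => [r| |] ubA; last by rewrite addNye leNye.
- rewrite addeC -leeBrDr//; apply/ereal_supP => z Az.
  by rewrite leeBrDr// addeC ubA.
- have := ubA y Ay; rewrite addye ?gt_eqF// leye_eq => /eqP ->.
  by rewrite leey.
Qed.

Lemma ereal_supD A B :
  ereal_sup [set x + y | x in A & y in B] = ereal_sup A + ereal_sup B.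
Proof.
rewrite addeC -ereal_supDl; apply/eqP; rewrite eq_le; apply/andP; split.
- apply/ereal_supP => _ [x Ax [y By <-]]; rewrite addeC.
  apply: (@le_trans _ _ (ereal_sup B + x)); first by rewrite leeD2r// ereal_sup_ubound.
  by apply: ereal_sup_ubound; exists x.
- apply/ereal_supP => _ [x Ax <-]; rewrite addeC -ereal_supDl.
  by apply: ereal_sup_le => _ [y By <-]; exists x => //; exists y.
Qed.

End ereal_supD.

Lemma ge0_cvge0 (R : realType) (I : Type) (F : set_system I) (g : I -> \bar R) :
  Filter F -> (forall i, 0 <= g i)%E ->
  (forall e : R, 0 < e -> \forall i \near F, (g i <= e%:E)%E) -> g @ F --> 0%E.
Proof.
move=> FF g_ge0 g_le; apply/fine_cvgP; split.
  by apply: filterS (g_le 1 ltr01) => i g1; rewrite ge0_fin_numE// (le_lt_trans g1) ?ltry.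
apply/cvgrPdist_le => e e0; apply: filterS (g_le e e0) => i ge /=.
rewrite sub0r normrN ger0_norm ?fine_ge0// -lee_fin fineK//.
by rewrite ge0_fin_numE// (le_lt_trans ge) ?ltry.
Qed.

Section lipschitz.
Variables (R : realType) (V W : normedModType R).

Lemma lipschitz_continuous (k : R) (f : V -> W) : k.-lipschitz f -> continuous f.
Proof.
move=> f_lip v; apply/cvgrPdist_le => e e0; near=> u.
apply: (le_trans (f_lip (v, u) _)) => //=.
have k1_gt0 : 0 < `|k| + 1 by rewrite ltr_wpDl.
apply: (@le_trans _ _ ((`|k| + 1) * `|v - u|)).
  by rewrite ler_wpM2r// ler_wpDr// ler_norm.
rewrite -ler_pdivlMl//; near: u.
by apply: cvgr_dist_le; [exact: cvg_id|rewrite mulr_gt0// invr_gt0].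
Unshelve. all: by end_near. Qed.

End lipschitz.

Section infconv.
Variables (R : realType) (V : normedModType R).

Definition infconv (f : V -> R) (k : R) (v : V) : R :=
  inf [set f y + k * `|v - y| | y in [set: V]].

Variables (f : V -> R) (c k : R).
Hypotheses (k_ge0 : 0 <= k) (f_ge : forall v, c <= f v).

Lemma infconv_le v y : infconv f k v <= f y + k * `|v - y|.
Proof.
apply: ge_inf; last by exists y.
by exists c => _ [z _ <-]; rewrite ler_wpDr// mulr_ge0.
Qed.

Lemma le_infconv v r : (forall y, r <= f y + k * `|v - y|) -> r <= infconv f k v.
Proof.
move=> r_le; apply: lb_le_inf; last by move=> _ [y _ <-].
by exists (f v + k * `|v - v|); exists v.
Qed.

Lemma infconv_le_fun v : infconv f k v <= f v.
Proof. by have := infconv_le v v; rewrite subrr normr0 mulr0 addr0. Qed.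

Lemma infconv_ge v : c <= infconv f k v.
Proof. by apply: le_infconv => y; rewrite ler_wpDr// mulr_ge0. Qed.

Lemma infconv_lipschitz : k.-lipschitz (infconv f k).
Proof.
have infconvB_le u v : infconv f k u - infconv f k v <= k * `|u - v|.
  rewrite lerBlDr -lerBlDl; apply: le_infconv => y.
  rewrite lerBlDl addrCA; apply: (le_trans (infconv_le u y)).
  by rewrite lerD2l -mulrDr ler_wpM2l// -(subrKA v) ler_normD.
by move=> [u v] _ /=; rewrite ler_norml lerNl opprB {1}distrC !infconvB_le.
Qed.

End infconv.

Lemma normr_infconv_le (R : realType) (V : normedModType R) (f : V -> R) (k C : R) (v : V) :
  0 <= k -> (forall u, `|f u| <= C) -> `|infconv f k v| <= C.
Proof.
move=> k0 f_bnd; have f_ge u : - C <= f u by exact: lerNnormlW.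
rewrite ler_norml (infconv_ge k0 f_ge)/=.
exact: le_trans (infconv_le_fun k0 f_ge v) (ler_normlW (f_bnd v)).
Qed.

Lemma cvg_infconv (R : realType) (V : normedModType R) (f : V -> R) (c : R) (v : V) :
  (forall u, c <= f u) -> {for v, continuous f} ->
  infconv f k v @[k --> +oo] --> f v.
Proof.
move=> f_ge f_cont; apply/cvgrPdist_le => e e0.
have /nbhs_ballP[r /= r0 f_ball] : \forall y \near v, `|f v - f y| <= e.
  by move/cvgrPdist_le: f_cont; exact.
near=> k.
have k0 : 0 <= k by near: k; exact: nbhs_pinfty_ge.
rewrite ger0_norm ?subr_ge0 ?(infconv_le_fun k0 f_ge)//.
rewrite lerBlDr -lerBlDl; apply: le_infconv => y.
have [vy_near|vy_far] := ltP `|v - y| r.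
  have := f_ball y; rewrite -ball_normE/= => /(_ vy_near); rewrite ler_norml => /andP[_].
  have : 0 <= k * `|v - y| by rewrite mulr_ge0.
  lra.
have : f v - c <= k * `|v - y|.
  apply: (@le_trans _ _ (k * r)); last by rewrite ler_wpM2l.
  by rewrite -ler_pdivrMr//; near: k; exact: nbhs_pinfty_ge.
have := f_ge y; lra.
Unshelve. all: by end_near. Qed.

Section row_norm.
Variables (R : realType) (n : nat).
Implicit Type v : 'rV[R]_n.

Lemma rV_norm_leP v (c : R) : 0 <= c ->
  reflect (forall i, `|v ord0 i| <= c) (`|v| <= c).
Proof.
move=> c0; rewrite [`|v|]/Num.Def.normr/= mx_normrE.
apply: (iffP (bigmax_leP _ _ _ _)) => [[_ v_le] i|v_le]; first exact: (v_le (ord0, i)).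
by split => // -[i j] _; rewrite ord1.
Qed.

Lemma norm_le_eucl v : `|v| <= eucl v.
Proof.
apply/rV_norm_leP => [|i]; first exact: sqrtr_ge0.
rewrite -sqrtr_sqr; apply: ler_wsqrtr; rewrite (bigD1 i)//= lerDl.
by apply: sumr_ge0 => j _; exact: sqr_ge0.
Qed.

Lemma eucl_le_norm v : eucl v <= n%:R * `|v|.
Proof.
rewrite -[leRHS]ger0_norm ?mulr_ge0// -sqrtr_sqr; apply: ler_wsqrtr.
apply: (@le_trans _ _ (\sum_(i < n) `|v| ^+ 2)).
  apply: ler_sum => i _; rewrite -real_normK ?num_real// lerXn2r ?nnegrE//.
  by move: i; exact/rV_norm_leP.
rewrite sumr_const card_ord -[leLHS]mulr_natl exprMn ler_wpM2r ?sqr_ge0//.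
by rewrite -natrX ler_nat; case: n => // m; rewrite leq_pmulr.
Qed.

Lemma lip1_cst (c : R) : lip1 (fun _ : 'rV[R]_n => c).
Proof. by move=> a b; rewrite subrr normr0 sqrtr_ge0. Qed.

Lemma lip1_lipschitz (D : 'rV[R]_n -> R) : lip1 D -> n%:R.-lipschitz D.
Proof. by move=> D_lip [a b] _ /=; apply: le_trans (D_lip _ _) (eucl_le_norm _). Qed.

Lemma lip1_continuous (D : 'rV[R]_n -> R) : lip1 D -> continuous D.
Proof. by move=> /lip1_lipschitz /lipschitz_continuous. Qed.

Lemma lipschitz_lip1 (k : R) (f : 'rV[R]_n -> R) : 0 < k ->
  k.-lipschitz f -> lip1 (fun v => k^-1 * f v).
Proof.
move=> k0 f_lip a b; rewrite -mulrBr normrM gtr0_norm ?invr_gt0// ler_pdivrMl//.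
apply: (le_trans (f_lip (a, b) _)) => //=.
by rewrite ler_wpM2l ?(ltW k0)// norm_le_eucl.
Qed.

End row_norm.

Definition rV_borel (R : realType) (k : nat) :=
  g_sigma_algebraType [set A : set 'rV[R]_k | open A].

Definition random_vector (d : measure_display) (T : measurableType d) (R : realType)
    (k : nat) (X : T -> 'rV[R]_k) : Prop :=
  measurable_fun setT (X : T -> rV_borel R k).

Definition rV_box (R : Type) (k : nat) (B : 'I_k -> set R) : set 'rV[R]_k :=
  [set v | forall i, B i (v ord0 i)].

Definition rV_boxes (R : realType) (k : nat) : set (set 'rV[R]_k) :=
  [set A | exists2 B : 'I_k -> set R, (forall i, measurable (B i)) & A = rV_box B].

Section borel_sigma_algebra.
Variables (R : realType) (k : nat).

Lemma open_rV_bigcup_box (A : set 'rV[R]_k) : open A ->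
  exists D : set ({ffun 'I_k -> rat} * rat),
    A = \bigcup_(a in D) rV_box (fun i => ball (ratr (a.1 i) : R) (ratr a.2)).
Proof.
move=> openA; exists [set a : {ffun 'I_k -> rat} * rat |
  rV_box (fun i => ball (ratr (a.1 i) : R) (ratr a.2)) `<=` A].
apply/seteqP; split=> [v Av|v [a boxA va]]; last exact: boxA.
have /nbhs_ballP[e /= e0 ball_sub] : nbhs v A by exact: open_nbhs_nbhs.
have [r] : exists r : rat, ratr r \in `]0, (e / 2)[.
  by apply: rat_in_itvoo; lra.
rewrite in_itv/= => /andP[r0 r_lt].
have /choice[q v_near_q] : forall i, exists q : rat, ball (ratr q : R) (ratr r) (v ord0 i).
  move=> i.
  have [q] : exists q : rat, ratr q \in `](v ord0 i - ratr r), (v ord0 i + ratr r)[.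
    by apply: rat_in_itvoo; lra.
  by rewrite in_itv/= => q_itv; exists q; rewrite /ball/= ltr_norml; lra.
exists ([ffun i => q i], r) => /= [u u_box|i]; last by rewrite ffunE.
apply: ball_sub; split=> // i j; rewrite ord1.
have := u_box j; have := v_near_q j; rewrite /= ffunE /ball/= !ltr_norml; lra.
Qed.

Lemma continuous_borel_fun (f : 'rV[R]_k -> R) : continuous f -> borel_fun f.
Proof.
move=> /continuousP cf A mA.
have mf : measurable_fun setT (f : rV_borel R k -> R).
  apply: (measurability _ (RGenOpens.measurableE R)) => _ [_ [a [b ->] <-]].
  by rewrite setTI; apply: sub_sigma_algebra; apply: cf; exact: interval_open.
by rewrite -[X in borel_rV X]setTI; exact: mf.
Qed.

Lemma borel_fun_measurable (F : 'rV[R]_k -> R) :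
  borel_fun F -> measurable_fun setT (F : rV_borel R k -> R).
Proof. by move=> bF _ A mA; rewrite setTI; exact: bF. Qed.

Lemma measurable_rV_coord (i : 'I_k) :
  measurable_fun setT (fun v : rV_borel R k => v ord0 i).
Proof.
apply: borel_fun_measurable; apply: continuous_borel_fun => v.
exact: coord_continuous.
Qed.

End borel_sigma_algebra.

Lemma measurable_preimage_box (d : measure_display) (T : measurableType d) (R : realType)
    (k : nat) (X : T -> 'rV[R]_k) (B : 'I_k -> set R) :
  (forall i, measurable_fun setT (fun w => X w ord0 i)) ->
  (forall i, measurable (B i)) -> measurable (X @^-1` rV_box B).
Proof.
move=> mX mB.
have -> : X @^-1` rV_box B = \bigcap_i ((fun w => X w ord0 i) @^-1` B i).
  by apply/seteqP; split=> w /= Xw i => [_|]; apply: Xw.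
by apply: fin_bigcap_measurable => // i _; rewrite -[X in measurable X]setTI; apply: mX.
Qed.

Lemma borel_rV_boxesE (R : realType) (k : nat) : @borel_rV R k = <<s @rV_boxes R k >>.
Proof.
apply/seteqP; split; apply: smallest_sub; try exact: smallest_sigma_algebra.
- move=> A /open_rV_bigcup_box[D ->]; rewrite bigcup_mkcond.
  apply: (@countable_bigcupT_measurable _ (g_sigma_algebraType (@rV_boxes R k))) => //.
  move=> a; case: ifP => _; last exact: measurable0.
  apply: sub_sigma_algebra; eexists; last reflexivity.
  by move=> i; rewrite /= ball_itv; exact: measurable_itv.
- move=> _ [B mB ->].
  apply: (@measurable_preimage_box _ (rV_borel R k) _ _ id B) => // i.
  exact: measurable_rV_coord.
Qed.

Section random_vectors.
Variables (d : measure_display) (T : measurableType d) (R : realType).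

Lemma random_vectorP (k : nat) (X : T -> 'rV[R]_k) :
  random_vector X <-> forall i, measurable_fun setT (fun w => X w ord0 i).
Proof.
split=> [mX i|mX]; first exact: measurableT_comp (measurable_rV_coord i) mX.
apply: (@measurability _ _ T (rV_borel R k) _ _ _ (borel_rV_boxesE R k)) => _ [_ [B mB ->] <-].
by rewrite setTI; exact: measurable_preimage_box.
Qed.

Lemma random_vector_row (k : nat) (Y : 'I_k -> T -> R) :
  (forall i, measurable_fun setT (Y i)) -> random_vector (fun w => \row_i Y i w).
Proof.
move=> mY; apply/random_vectorP => i.
by under eq_fun do rewrite mxE; exact: mY.
Qed.

Lemma measurable_borel_comp (k : nat) (F : 'rV[R]_k -> R) (X : T -> 'rV[R]_k) :
  borel_fun F -> random_vector X -> measurable_fun setT (F \o X).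
Proof. by move=> /borel_fun_measurable mF mX; exact: (measurableT_comp mF mX). Qed.

Lemma measurable_preimage_borel (k : nat) (X : T -> 'rV[R]_k) (A : set 'rV[R]_k) :
  random_vector X -> borel_rV A -> measurable (X @^-1` A).
Proof. by move=> mX bA; rewrite -[X in measurable X]setTI; apply: mX. Qed.

Lemma random_vector_block (n : nat) (X : int -> T -> R) (t : int) :
  rv_process X -> random_vector (block n X t).
Proof. by move=> mX; apply: random_vector_row => i; exact: mX. Qed.

End random_vectors.

Section laws.
Variables (d : measure_display) (T : measurableType d) (R : realType).
Variable P : probability T R.

Definition law (k : nat) (X : T -> 'rV[R]_k) (mX : random_vector X) :
    probability (rV_borel R k) R :=
  distribution P
    (HB.pack_for {RV P >-> rV_borel R k} X (isMeasurableFun.Build _ _ _ _ _ mX)).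

Lemma same_law_boxes (k : nat) (X Y : T -> 'rV[R]_k) :
  random_vector X -> random_vector Y ->
  (forall B : 'I_k -> set R, (forall i, measurable (B i)) ->
     P (X @^-1` rV_box B) = P (Y @^-1` rV_box B)) ->
  same_law P X Y.
Proof.
move=> mX mY eq_boxes; change (forall A, borel_rV A -> law mX A = law mY A).
apply: (@measure_unique _ R (rV_borel R k) (@rV_boxes R k) (fun=> setT) _ _ _ _
  (law mX) (law mY)).
- exact: borel_rV_boxesE.
- move=> _ _ [B mB ->] [C mC ->]; exists (fun i => B i `&` C i).
    by move=> i; exact: measurableI.
  apply/seteqP; split=> v /=; first by move=> [vB vC] i; split; [exact: vB|exact: vC].
  by move=> vBC; split=> i; have [] := vBC i.
- by move=> _; exists (fun=> setT) => //; apply/seteqP; split.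
- by rewrite bigcup_const.
- by move=> _ [B mB ->]; exact: eq_boxes.
- by move=> _; rewrite -ge0_fin_numE//; exact: fin_num_measure.
Qed.

Lemma same_law_comp (k l : nat) (X Y : T -> 'rV[R]_k) (F : 'rV[R]_k -> 'rV[R]_l) :
  random_vector (F : rV_borel R k -> 'rV[R]_l) ->
  same_law P X Y -> same_law P (F \o X) (F \o Y).
Proof.
move=> mF XY A bA.
exact: XY (measurable_preimage_borel mF bA).
Qed.

Lemma mutually_independent_box (I : eqType) (X : I -> T -> R) (k : nat)
    (idx : 'I_k -> I) (B : 'I_k -> set R) :
  mutually_independent P X -> injective idx -> (forall i, measurable (B i)) ->
  P ((fun w => \row_i X (idx i) w) @^-1` rV_box B) =
  (\prod_(i < k) P (X (idx i) @^-1` B i))%E.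
Proof.
move=> [_ indX] idx_inj mB.
pose C (j : I) : set R := if [pick i | idx i == j] is Some i then B i else setT.
have C_idx i : C (idx i) = B i.
  by rewrite /C; case: pickP => [i' /eqP/idx_inj -> //|/(_ i)]; rewrite eqxx.
have mC j : measurable (C j) by rewrite /C; case: pickP.
have := indX [seq idx i | i <- enum 'I_k] C.
rewrite map_inj_uniq ?enum_uniq// => /(_ isT mC); rewrite big_map big_enum/=.
under eq_bigr do rewrite C_idx.
move=> <-; congr (P _); apply/seteqP; split=> w /= Xw.
  by move=> _ /mapP[i _ ->]; rewrite C_idx; have := Xw i; rewrite mxE.
by move=> i; rewrite mxE -C_idx; apply: Xw; rewrite /= map_f// mem_enum.
Qed.

Lemma same_law_independent (I J : eqType) (X : I -> T -> R) (Y : J -> T -> R)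
    (k : nat) (idx : 'I_k -> I) (jdx : 'I_k -> J) :
  mutually_independent P X -> mutually_independent P Y ->
  injective idx -> injective jdx ->
  (forall i (B : set R), measurable B ->
     P (X (idx i) @^-1` B) = P (Y (jdx i) @^-1` B)) ->
  same_law P (fun w => \row_i X (idx i) w) (fun w => \row_i Y (jdx i) w).
Proof.
move=> indX indY idx_inj jdx_inj eq_marginals; apply: same_law_boxes.
- by apply: random_vector_row => i; case: indX.
- by apply: random_vector_row => i; case: indY.
move=> B mB; rewrite !mutually_independent_box//.
by apply: eq_bigr => i _; exact: eq_marginals.
Qed.

Lemma expect_law (k : nat) (f : 'rV[R]_k -> R) (X : T -> 'rV[R]_k)
    (mX : random_vector X) :
  borel_fun f -> expect P f X = (\int[law mX]_v (f v)%:E)%E.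
Proof.
move=> /borel_fun_measurable mf.
have mEf : measurable_fun setT (EFin \o f : rV_borel R k -> \bar R).
  exact/measurable_EFinP.
rewrite /expect integralE [in RHS]integralE.
rewrite !ge0_integral_distribution//.
- by congr (_ - _)%E; apply: eq_integral => w _; rewrite /= ?funeposE ?funenegE.
- exact: measurable_funeneg.
- exact: measurable_funepos.
Qed.

Lemma same_law_expect (k : nat) (X Y : T -> 'rV[R]_k) (f : 'rV[R]_k -> R) :
  random_vector X -> random_vector Y -> borel_fun f ->
  same_law P X Y -> expect P f X = expect P f Y.
Proof.
move=> mX mY bf XY; rewrite (expect_law mX bf) (expect_law mY bf).
by apply: eq_measure_integral => A mA _; exact: XY.
Qed.

Lemma conv_dist_same_law (n : nat) (Xm Ym : nat -> T -> 'rV[R]_n) (X Y : T -> 'rV[R]_n) :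
  (forall m, random_vector (Xm m)) -> (forall m, random_vector (Ym m)) ->
  random_vector X -> random_vector Y ->
  (forall m, same_law P (Xm m) (Ym m)) -> same_law P X Y ->
  conv_dist P Xm X -> conv_dist P Ym Y.
Proof.
move=> mXm mYm mX mY XYm XY cvgX f f_cont f_bnd.
have bf := continuous_borel_fun f_cont.
rewrite -(same_law_expect mX mY bf XY).
under eq_cvg do rewrite -(same_law_expect (mXm _) (mYm _) bf (XYm _)).
exact: cvgX.
Qed.

End laws.

Section bounded_expectation.
Variables (d : measure_display) (T : measurableType d) (R : realType).
Variable P : probability T R.

Lemma ae_bounded_integrable (f : T -> R) (C : R) : measurable_fun setT f ->
  (\forall w \ae P, `|f w| <= C) -> P.-integrable setT (EFin \o f).
Proof.
move=> mf f_le; apply/integrableP; split; first exact/measurable_EFinP.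
apply: (@le_lt_trans _ _ (\int[P]_w (`|C|%:E))%E).
  apply: ae_ge0_le_integral => //=.
  - exact/measurable_EFinP/measurableT_comp.
  - by apply: filterS f_le => w fw _; rewrite lee_fin (le_trans fw)// ler_norm.
by rewrite integral_cst//= probability_setT mule1 ltry.
Qed.

Lemma integralB_le (f g : T -> R) (c : R) : 0 <= c ->
  P.-integrable setT (EFin \o f) -> P.-integrable setT (EFin \o g) ->
  (\forall w \ae P, `|f w - g w| <= c) ->
  (\int[P]_w (f w)%:E - \int[P]_w (g w)%:E <= c%:E)%E.
Proof.
move=> c0 intf intg fg_le; rewrite -(integralB measurableT intf intg)/=.
have mfg : measurable_fun setT (fun w => (f w)%:E - (g w)%:E)%E.
  exact: (measurable_int _ (integrableB measurableT intf intg)).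
apply: (le_trans (lee_abs _)); apply: (le_trans (le_abse_integral _ measurableT mfg)).
apply: (@le_trans _ _ (\int[P]_w (c%:E))%E); last first.
  by rewrite integral_cst//= probability_setT mule1.
apply: ae_ge0_le_integral => //.
- exact: (measurableT_comp (@abse_measurable _ _) mfg).
- by apply: filterS fg_le => w fgw _; rewrite -EFinB lee_fin.
Qed.

Variables (n : nat) (f : 'rV[R]_n -> R) (C : R) (X : T -> 'rV[R]_n).
Hypotheses (bf : borel_fun f) (f_bnd : forall v, `|f v| <= C) (mX : random_vector X).

Lemma integrable_bounded_borel : P.-integrable setT (EFin \o (f \o X)).
Proof.
apply: (@ae_bounded_integrable _ C); first exact: measurable_borel_comp.
by apply: nearW => w; exact: f_bnd.
Qed.

Lemma expect_fin_num : expect P f X \is a fin_num.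
Proof. exact: integrable_fin_num integrable_bounded_borel. Qed.

Lemma expectZl (c : R) : expect P (fun v => c * f v) X = (c%:E * expect P f X)%E.
Proof. by rewrite /expect -(integralZl measurableT integrable_bounded_borel). Qed.

End bounded_expectation.

Section wasserstein.
Variables (d : measure_display) (T : measurableType d) (R : realType).
Variable P : probability T R.
Variable n : nat.
Implicit Types (X Y : T -> 'rV[R]_n) (f : 'rV[R]_n -> R).

(* The Kantorovich-Rubinstein dual form. If [D] is not integrable under one of the two
   laws, the corresponding difference is a junk value. *)
Definition wasserstein1 X Y : \bar R :=
  ereal_sup [set expect P D X - expect P D Y | D in [set D | lip1 D]]%E.

Lemma wasserstein1_ge0 X Y : (0 <= wasserstein1 X Y)%E.
Proof.
apply: ereal_sup_ubound; exists (fun=> 0); first exact: lip1_cst.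
by rewrite /expect !integral0 subee.
Qed.

Lemma same_law_wasserstein1 X X' Y : random_vector X -> random_vector X' ->
  same_law P X X' -> wasserstein1 X Y = wasserstein1 X' Y.
Proof.
move=> mX mX' XX'; congr ereal_sup; apply: eq_imagel => D D_lip.
have bD := continuous_borel_fun (lip1_continuous D_lip).
by rewrite (same_law_expect mX mX' bD XX').
Qed.

Lemma wasserstein1_le X Y (C c : R) : random_vector X -> random_vector Y -> 0 <= c ->
  (\forall w \ae P, `|X w| <= C) -> (\forall w \ae P, `|X w - Y w| <= c) ->
  (wasserstein1 X Y <= (n%:R * c)%:E)%E.
Proof.
move=> mX mY c0 X_le XY_le; apply/ereal_supP => _ [D D_lip <-].
have bD := continuous_borel_fun (lip1_continuous D_lip).
have DB_le a b r : `|a - b| <= r -> `|D a - D b| <= n%:R * r.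
  move=> ab; apply: le_trans (D_lip _ _) _; apply: le_trans (eucl_le_norm _) _.
  by rewrite ler_wpM2l.
have DXY_le : \forall w \ae P, `|D (X w) - D (Y w)| <= n%:R * c.
  by apply: filterS XY_le => w; exact: DB_le.
have DX_le : \forall w \ae P, `|D (X w)| <= `|D 0| + n%:R * C.
  apply: filterS X_le => w Xw; rewrite -lerBlDl (le_trans (lerB_dist _ _))//.
  by apply: DB_le; rewrite subr0.
have DY_le : \forall w \ae P, `|D (Y w)| <= `|D 0| + n%:R * C + n%:R * c.
  apply: filterS2 DX_le DXY_le => w DXw DXYw.
  rewrite -[D (Y w)](subKr (D (X w))).
  by apply: (le_trans (ler_normB _ _)); exact: lerD.
apply: integralB_le DXY_le; first by rewrite mulr_ge0.
- by apply: ae_bounded_integrable DX_le; exact: measurable_borel_comp.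
- by apply: ae_bounded_integrable DY_le; exact: measurable_borel_comp.
Qed.

Lemma cvg_wasserstein1_unif (Xm : nat -> T -> 'rV[R]_n) X (C : R) :
  (forall m, random_vector (Xm m)) -> random_vector X ->
  (\forall w \ae P, `|X w| <= C) ->
  (forall e : R, 0 < e ->
     \forall m \near \oo, \forall w \ae P, `|X w - Xm m w| <= e) ->
  wasserstein1 X (Xm m) @[m --> \oo] --> 0%E.
Proof.
move=> mXm mX X_le X_unif.
apply: ge0_cvge0 => [m|e e0]; first exact: wasserstein1_ge0.
have n1_gt0 : 0 < n%:R + 1 :> R by rewrite ltr_wpDl.
have c_gt0 : 0 < e / (n%:R + 1) by rewrite divr_gt0.
apply: filterS (X_unif _ c_gt0) => m XXm_le.
apply: le_trans (wasserstein1_le mX (mXm m) (ltW c_gt0) X_le XXm_le) _.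
by rewrite lee_fin mulrCA ler_piMr ?(ltW e0)// ler_pdivrMr// mul1r lerDl.
Qed.

Lemma expectB_le_wasserstein1 (k C : R) f X Y : 0 < k ->
  k.-lipschitz f -> (forall v, `|f v| <= C) -> random_vector X -> random_vector Y ->
  (expect P f X - expect P f Y <= k%:E * wasserstein1 X Y)%E.
Proof.
move=> k0 f_lip f_bnd mX mY.
have bf := continuous_borel_fun (lipschitz_continuous f_lip).
have finX := expect_fin_num P bf f_bnd mX; have finY := expect_fin_num P bf f_bnd mY.
rewrite -lee_pdivrMl// muleBr ?fin_num_adde_defr//.
rewrite -!(expectZl P bf f_bnd)//.
by apply: ereal_sup_ubound; exists (fun v => k^-1 * f v) => //; exact: lipschitz_lip1.
Qed.

End wasserstein.

Section conv_dist_wasserstein1.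
Variables (d : measure_display) (T : measurableType d) (R : realType).
Variables (P : probability T R) (n : nat).

Lemma cvg_expect_infconv (f : 'rV[R]_n -> R) (C : R) (X : T -> 'rV[R]_n) :
  continuous f -> (forall v, `|f v| <= C) -> random_vector X ->
  expect P (infconv f k%:R) X @[k --> \oo] --> expect P f X.
Proof.
move=> f_cont f_bnd mX.
have f_ge v : - C <= f v by exact: lerNnormlW.
have measurable_comp (g : 'rV[R]_n -> R) : continuous g -> measurable_fun setT (g \o X).
  by move=> g_cont; apply: measurable_borel_comp => //; exact: continuous_borel_fun.
have [] // := @dominated_convergence _ _ _ P setT measurableT
  (fun k w => (infconv f k%:R (X w))%:E) (fun w => (f (X w))%:E) (fun=> C%:E).
- move=> k; apply/measurable_EFinP; apply: measurable_comp.
  exact: lipschitz_continuous (infconv_lipschitz (ler0n _ _) f_ge).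
- by apply/measurable_EFinP; exact: measurable_comp.
- apply: nearW => w _; apply: cvg_EFin; first exact: nearW.
  exact: cvg_comp cvgr_idn (cvg_infconv f_ge (f_cont _)).
- exact: finite_measure_integrable_cst.
- by apply: nearW => w k _; rewrite lee_fin normr_infconv_le.
Qed.

Lemma expectB_infconv_le (f : 'rV[R]_n -> R) (C k : R) (X Y : T -> 'rV[R]_n) :
  0 < k -> continuous f -> (forall v, `|f v| <= C) ->
  random_vector X -> random_vector Y ->
  (expect P f X - expect P f Y <=
   (expect P f X - expect P (infconv f k) X) + k%:E * wasserstein1 P X Y)%E.
Proof.
move=> k0 f_cont f_bnd mX mY.
have f_ge v : - C <= f v by exact: lerNnormlW.
have fk_lip := infconv_lipschitz (ltW k0) f_ge.
have fk_bnd v : `|infconv f k v| <= C by exact: normr_infconv_le (ltW k0) f_bnd.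
have bf := continuous_borel_fun f_cont.
have bfk := continuous_borel_fun (lipschitz_continuous fk_lip).
have fin_fk := expect_fin_num P bfk fk_bnd mX.
apply: (@le_trans _ _ (expect P f X - expect P (infconv f k) Y)%E).
  apply: leeB => //; apply: le_integral => //.
  - exact: integrable_bounded_borel bfk fk_bnd mY.
  - exact: integrable_bounded_borel bf f_bnd mY.
  - by move=> w _; rewrite lee_fin (infconv_le_fun (ltW k0) f_ge).
apply: le_trans (leeD2l _ (expectB_le_wasserstein1 P k0 fk_lip fk_bnd mX mY)).
by rewrite addeA subeK.
Qed.

Variables (Xm : nat -> T -> 'rV[R]_n) (X : T -> 'rV[R]_n).
Hypotheses (mXm : forall m, random_vector (Xm m)) (mX : random_vector X).
Hypothesis W_cvg0 : wasserstein1 P X (Xm m) @[m --> \oo] --> 0%E.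

Lemma near_expectB_le (f : 'rV[R]_n -> R) (C e : R) :
  continuous f -> (forall v, `|f v| <= C) -> 0 < e ->
  \forall m \near \oo, (expect P f X - expect P f (Xm m) <= e%:E)%E.
Proof.
move=> f_cont f_bnd e0; have e2_gt0 : (0 < (e / 2)%:E :> \bar R)%E by rewrite lte_fin divr_gt0.
have fin_f := expect_fin_num P (continuous_borel_fun f_cont) f_bnd mX.
have infconv_cvg0 : (expect P f X - expect P (infconv f k%:R) X)%E @[k --> \oo] --> 0%E.
  rewrite -(subee fin_f); apply: cvgeB; first by rewrite fin_num_adde_defr.
    exact: cvg_cst.
  exact: cvg_expect_infconv f_cont f_bnd mX.
have [k [k0 infconv_close]] : exists k : nat, 0 < k%:R :> R /\
    (expect P f X - expect P (infconv f k%:R) X < (e / 2)%:E)%E.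
  apply: (@filter_ex _ \oo); apply: filterI; last exact: infconv_cvg0 (open_ereal_lt' e2_gt0).
  by apply: filterS (nbhs_infty_gt 0) => k; rewrite ltr0n.
have kW_cvg0 : ((k%:R : R)%:E * wasserstein1 P X (Xm m))%E @[m --> \oo] --> 0%E.
  by rewrite -(mule0 k%:R%:E); exact: cvgeZl.
have : \forall m \near \oo, ((k%:R : R)%:E * wasserstein1 P X (Xm m) < (e / 2)%:E)%E.
  exact: kW_cvg0 _ (open_ereal_lt' e2_gt0).
apply: filterS => m kW_lt.
apply: (le_trans (expectB_infconv_le k0 f_cont f_bnd mX (mXm m))).
by rewrite [e]splitr EFinD leeD// ltW.
Qed.

Lemma conv_dist_wasserstein1 : conv_dist P Xm X.
Proof.
move=> f f_cont [C f_bnd].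
have fN_cont : continuous (\- f) by move=> v; exact: cvgN (f_cont v).
have fN_bnd v : `|(\- f) v| <= C by rewrite normrN.
have fin_f Y : random_vector Y -> expect P f Y \is a fin_num.
  exact: expect_fin_num (continuous_borel_fun f_cont) f_bnd.
have expectN Y : random_vector Y -> expect P (\- f) Y = (- expect P f Y)%E.
  move=> mY; rewrite -mulN1e -(expectZl P (continuous_borel_fun f_cont) f_bnd mY).
  by congr expect; apply/funext => v; rewrite mulN1r.
rewrite -(fineK (fin_f _ mX)); apply/fine_cvgP; split.
  by apply: nearW => m; exact: fin_f.
apply/cvgrPdist_le => e e0.
apply: filterS2 (near_expectB_le f_cont f_bnd e0) (near_expectB_le fN_cont fN_bnd e0).
move=> m /=; rewrite !expectN// -(fineK (fin_f _ mX)) -(fineK (fin_f _ (mXm m)))/=.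
by rewrite -?EFinN -?EFinD !lee_fin ler_norml; lra.
Qed.

End conv_dist_wasserstein1.

Section loss.
Variables (d : measure_display) (T : measurableType d) (R : realType).
Variables (P : probability T R) (lam : R) (n : nat).
Variables (u : T -> 'rV[R]_n) (x : int -> T -> R).
Hypothesis lam_gt0 : 0 < lam.

Lemma lossE (m : nat) (Gm Hm : 'rV[R]_m -> R) :
  loss P lam u x Gm Hm =
  (wasserstein1 P u (block n (nu_m Gm x) 0) +
   lam%:E * wasserstein1 P (block n x 0) (block n (xhat_m Gm Hm x) 0))%E.
Proof.
rewrite /wasserstein1 -ereal_sup_pZl// -ereal_supD; congr ereal_sup.
apply/seteqP; split.
- move=> _ [Dg Dg_lip [Dw Dw_lip <-]]; eexists; first by exists Dg.
  by eexists; [eexists; [exists Dw|reflexivity]|].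
- move=> _ [_ [Dg Dg_lip <-] [_ [_ [Dw Dw_lip <-] <-] <-]].
  by exists Dg => //; exists Dw.
Qed.

Lemma loss_ge0 (m : nat) (Gm Hm : 'rV[R]_m -> R) : (0 <= loss P lam u x Gm Hm)%E.
Proof. by rewrite lossE adde_ge0 ?mule_ge0 ?wasserstein1_ge0// lee_fin ltW. Qed.

Variables (Gm Hm : forall m : nat, 'rV[R]_m -> R).
Let W_nu m := wasserstein1 P u (block n (nu_m (@Gm m) x) 0).
Let W_x m := wasserstein1 P (block n x 0) (block n (xhat_m (@Gm m) (@Hm m) x) 0).

Lemma loss_cvg0P : loss P lam u x (@Gm m) (@Hm m) @[m --> \oo] --> 0%E <->
  W_nu m @[m --> \oo] --> 0%E /\ W_x m @[m --> \oo] --> 0%E.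
Proof.
have lamW_ge0 m : (0 <= lam%:E * W_x m)%E.
  by rewrite mule_ge0 ?wasserstein1_ge0// lee_fin ltW.
have -> : (fun m => loss P lam u x (@Gm m) (@Hm m)) = (fun m => W_nu m + lam%:E * W_x m)%E.
  by apply/funext => m; exact: lossE.
split=> [loss0|[W_nu0 W_x0]]; last first.
  have lamW0 : (lam%:E * W_x m)%E @[m --> \oo] --> 0%E.
    by rewrite -(mule0 lam%:E); exact: cvgeZl.
  by rewrite -(adde0 0%E); exact: cvgeD.
have squeeze0 (g : nat -> \bar R) :
    (forall m, 0 <= g m <= W_nu m + lam%:E * W_x m)%E -> g m @[m --> \oo] --> 0%E.
  move=> g_le; apply: squeeze_cvge loss0; last exact: cvg_cst.
  exact: nearW g_le.
split; first by apply: squeeze0 => m; rewrite wasserstein1_ge0 leeDl.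
have lamW0 : (lam%:E * W_x m)%E @[m --> \oo] --> 0%E.
  by apply: squeeze0 => m; rewrite lamW_ge0 leeDr// wasserstein1_ge0.
have W_xE m : W_x m = (lam^-1%:E * (lam%:E * W_x m))%E.
  by rewrite muleA -EFinM mulVf ?mul1e// gt_eqF.
by rewrite (funext W_xE) -(mule0 lam^-1%:E); exact: cvgeZl.
Qed.

End loss.

Section continuous_seq.
Variables (R : realType) (K : set {ptws nat -> R}) (H : (nat -> R) -> R).
Hypotheses (compactK : compact K) (H_cont : continuous_seq H).

Lemma nbhs_seq_coord (s : {ptws nat -> R}) (N : nat) (e : R) : 0 < e ->
  \forall s' \near s, forall k, (k < N)%N -> `|s k - s' k| < e.
Proof.
move=> e0; elim: N => [|N near_lt_N]; first exact: (@filterE _ (nbhs s)).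
have near_eq_N : \forall s' \near s, `|s N - s' N| < e.
  have /(@cvgrPdist_lt R R {ptws nat -> R} (nbhs s)) :=
    @proj_continuous nat (fun=> R) N s.
  exact.
apply: (@filterS2 _ (nbhs s) _ _ _ _ _ near_lt_N near_eq_N) => s' lt_N eq_N k.
by rewrite ltnS leq_eqVlt => /predU1P[->//|]; exact: lt_N.
Qed.

Lemma continuous_seq_continuous : continuous (H : {ptws nat -> R} -> R).
Proof.
move=> s; apply/(@cvgrPdist_lt R R {ptws nat -> R} (nbhs s)) => e e0.
have [N [del [del0 H_close]]] := H_cont s e0.
exact: (@filterS _ (nbhs s) _ _ _ H_close (nbhs_seq_coord s N del0)).
Qed.

Lemma continuous_seq_bounded_on_compact :
  exists C : R, forall s, K s -> `|H s| <= C.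
Proof.
have /compact_bounded[M [_ M_bnd]] : compact ((H : {ptws nat -> R} -> R) @` K).
  apply: continuous_compact compactK.
  exact/continuous_subspaceT/continuous_seq_continuous.
by exists (M + 1) => s Ks; apply: M_bnd; [rewrite ltrDl|exists s].
Qed.

(* The second argument may leave the compact set: the networks approximating an innovations
   path in [0, 1]^N need not take their values in [0, 1]. *)
Lemma continuous_seq_unif_near_compact (e : R) : 0 < e ->
  exists2 del : R, 0 < del & forall s, K s ->
    forall s', (forall k, `|s k - s' k| < del) -> `|H s - H s'| < e.
Proof.
move=> e0; have e2_gt0 : 0 < e / 2 by rewrite divr_gt0.
pose close_at del s := forall s' : nat -> R,
  (forall k, `|s k - s' k| < del) -> `|H s - H s'| < e.
have : \forall del \near 0^'+, K `<=` close_at del.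
  apply: (compact_near_coveringP K).1 compactK _ _ _ _ _ => s _.
  have [N [del [del0 H_close]]] := H_cont s e2_gt0.
  exists ([set s' | forall k, (k < N)%N -> `|s k - s' k| < del / 2], [set r | r < del / 2]).
    split=> /=; first by apply: nbhs_seq_coord; rewrite divr_gt0.
    by apply: nbhs_right_lt; rewrite divr_gt0.
  move=> [s1 r] [/= s_s1 r_lt] s2 s1_s2.
  have H_s1 : `|H s - H s1| < e / 2.
    by apply: H_close => k kN; have := s_s1 k kN; lra.
  have H_s2 : `|H s - H s2| < e / 2.
    apply: H_close => k kN; rewrite -(subrKA (s1 k)) (le_lt_trans (ler_normD _ _))//.
    by have := s_s1 k kN; have := s1_s2 k; lra.
  by rewrite -(subrKA (H s)) (le_lt_trans (ler_normD _ _))// distrC; lra.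
move=> near_close.
have [del [del0 close_del]] : exists del, 0 < del /\ K `<=` close_at del.
  by apply: (@filter_ex _ 0^'+); apply: filterI near_close; exact: nbhs_right_gt.
by exists del.
Qed.

End continuous_seq.

Definition unit_cube (R : realType) : set {ptws nat -> R} :=
  [set s | forall k, `[0, 1]%classic (s k)].

Lemma compact_unit_cube (R : realType) : compact (@unit_cube R).
Proof.
apply: (@tychonoff nat (fun=> R) (fun=> `[0, 1]%classic)) => _.
exact: segment_compact.
Qed.

Section network_processes.
Variables (d : measure_display) (T : measurableType d) (R : realType).
Implicit Type x : int -> T -> R.

Lemma xhat_mE (m : nat) (Gm Hm : 'rV[R]_m -> R) x :
  xhat_m Gm Hm x = nu_m Hm (nu_m Gm x).
Proof. by []. Qed.

Lemma rv_process_nu_m (m : nat) (F : 'rV[R]_m -> R) x :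
  borel_fun F -> rv_process x -> rv_process (nu_m F x).
Proof.
by move=> bF mx t; apply: (measurable_borel_comp bF); exact: random_vector_block.
Qed.

Lemma unif_conv_nu_m (Fm : forall m : nat, 'rV[R]_m -> R) (F : (nat -> R) -> R) (e : R) :
  unif_conv Fm F -> 0 < e ->
  \forall m \near \oo, forall x t w, `|causal F x t w - nu_m (Fm m) x t w| <= e.
Proof.
move=> FmF e0; have [M FmF_le] := FmF e e0; near=> m => x t w.
by rewrite distrC; apply: (FmF_le m); near: m; exact: nbhs_infty_ge.
Unshelve. all: by end_near. Qed.

Lemma unif_conv_xhat_m (Gm Hm : forall m : nat, 'rV[R]_m -> R) (G H : (nat -> R) -> R)
    (K : set {ptws nat -> R}) (e : R) :
  compact K -> continuous_seq H -> unif_conv Gm G -> unif_conv Hm H -> 0 < e ->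
  \forall m \near \oo, forall x t w, K (fun k => causal G x (t - k%:Z) w) ->
    `|causal H (causal G x) t w - xhat_m (Gm m) (Hm m) x t w| <= e.
Proof.
move=> compactK H_cont GmG HmH e0; have e2_gt0 : 0 < e / 2 by rewrite divr_gt0.
have [del del0 H_unif] := continuous_seq_unif_near_compact compactK H_cont e2_gt0.
have del2_gt0 : 0 < del / 2 by rewrite divr_gt0.
apply: filterS2 (unif_conv_nu_m GmG del2_gt0) (unif_conv_nu_m HmH e2_gt0).
move=> m Gm_close Hm_close x t w K_past; rewrite -(subrKA (causal H (nu_m (Gm m) x) t w)).
rewrite (le_trans (ler_normD _ _))// [leRHS]splitr lerD//.
apply/ltW/H_unif => // k; apply: le_lt_trans (Gm_close _ _ _) _; lra.
Qed.

End network_processes.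

Section stationary_processes.
Variables (d : measure_display) (T : measurableType d) (R : realType).
Variable P : probability T R.

Lemma stationary_block (n : nat) (x : int -> T -> R) (s t : int) :
  stationary P x -> same_law P (block n x s) (block n x t).
Proof.
have blockE t' : block n x t' = fdvec x (fun i : 'I_n => - i%:Z + t').
  by apply/funext => w; apply/rowP => i; rewrite !mxE addrC.
by move=> [_ x_shift] A bA; rewrite !blockE !x_shift.
Qed.

(* The joint law of finitely many filtered values is the image of that of the matrix of the
   values of [x] entering them, whose indices are gathered in [mxvec]. *)
Lemma stationary_nu_m (m : nat) (F : 'rV[R]_m -> R) (x : int -> T -> R) :
  borel_fun F -> stationary P x -> stationary P (nu_m F x).
Proof.
move=> bF [mx x_shift]; split; first exact: rv_process_nu_m.
move=> k idx h.
pose window (idx : 'I_k -> int) := mxvec (\matrix_(i < k, j < m) (idx i - j%:Z)) ord0.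
pose apply_rows (v : 'rV[R]_(k * m)) := \row_i F (\row_j v ord0 (mxvec_index i j)).
have fdvecE idx' : fdvec (nu_m F x) idx' = apply_rows \o fdvec x (window idx').
  apply/funext => w; apply/rowP => i; rewrite !mxE; congr F.
  by apply/rowP => j; rewrite !mxE /window mxvecE mxE.
have window_shift : window (fun i => idx i + h) = (fun l => window idx l + h).
  by apply/funext; case/mxvec_indexP => i j; rewrite /window !mxvecE !mxE addrAC.
rewrite !fdvecE window_shift; apply: same_law_comp; last exact: x_shift.
apply: random_vector_row => i; apply: (measurable_borel_comp bF).
by apply: random_vector_row => j; exact: measurable_rV_coord.
Qed.

End stationary_processes.

Section uniform_innovations.
Variables (d : measure_display) (T : measurableType d) (R : realType).
Variable P : probability T R.

Lemma uniform01_ae (Y : T -> R) : measurable_fun setT Y -> uniform01 P Y ->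
  \forall w \ae P, `[0, 1]%classic (Y w).
Proof.
move=> mY uY; exists (Y @^-1` (~` `[0, 1])); split.
- by rewrite -[X in measurable X]setTI; apply: mY => //; exact: measurableC.
- by rewrite uY ?setICl ?measure0//; exact: measurableC.
- by [].
Qed.

Lemma iid_uniform_unit_cube (nu : int -> T -> R) (t : int) : iid_uniform P nu ->
  \forall w \ae P, forall i : nat, unit_cube (fun k => nu (t - i%:Z - k%:Z) w).
Proof.
move=> [[mnu _] unu].
have : \forall w \ae P, forall j : nat, `[0, 1]%classic (nu (t - j%:Z) w).
  by apply/ae_foralln => j; exact: uniform01_ae.
by apply: filterS => w nu01 i k; rewrite -addrA -opprD -PoszD.
Qed.

Lemma same_law_uvec_block (n : nat) (U : nat -> T -> R) (nu : int -> T -> R) (t : int) :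
  iid_uniform P U -> iid_uniform P nu -> same_law P (uvec n U) (block n nu t).
Proof.
move=> [indU unifU] [indnu unifnu]; apply: same_law_independent => //.
- exact: val_inj.
- by move=> i j /addrI/oppr_inj [] /val_inj.
- by move=> i B mB; rewrite unifU ?unifnu.
Qed.

Lemma random_vector_uvec (n : nat) (U : nat -> T -> R) :
  iid_uniform P U -> random_vector (uvec n U).
Proof. by move=> [[mU _] _]; exact: random_vector_row. Qed.

End uniform_innovations.

Section feasible_networks.
Variables (d : measure_display) (T : measurableType d) (R : realType).
Variables (P : probability T R) (x : int -> T -> R) (U : nat -> T -> R) (n : nat).
Variables (G H : (nat -> R) -> R) (Gm Hm : forall m : nat, 'rV[R]_m -> R).
Hypotheses (mx : rv_process x) (iidU : iid_uniform P U).
Hypotheses (bGm : forall m, borel_fun (@Gm m)) (bHm : forall m, borel_fun (@Hm m)).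
Hypothesis innovations : weak_innovations P x G H.
Hypotheses (GmG : unif_conv Gm G) (HmH : unif_conv Hm H).

Let iid_nu : iid_uniform P (causal G x). Proof. by case: innovations. Qed.

Let mnu : rv_process (causal G x). Proof. by case: iid_nu => -[]. Qed.

Lemma cvg_wasserstein1_nu_m :
  wasserstein1 P (uvec n U) (block n (nu_m (@Gm m) x) 0) @[m --> \oo] --> 0%E.
Proof.
have mu : random_vector (uvec n U) := random_vector_uvec iidU.
have mblock : random_vector (block n (causal G x) 0) := random_vector_block 0 mnu.
have same_u_nu : same_law P (uvec n U) (block n (causal G x) 0).
  exact: same_law_uvec_block.
under eq_cvg do rewrite (same_law_wasserstein1 _ mu mblock same_u_nu).
apply: (@cvg_wasserstein1_unif _ _ _ _ _ _ _ 1).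
- by move=> m; apply: random_vector_block; exact: rv_process_nu_m.
- exact: random_vector_block.
- apply: filterS (iid_uniform_unit_cube 0 iid_nu) => w nu01.
  apply/rV_norm_leP => // i; rewrite mxE; have := nu01 i 0%N.
  by rewrite /= subr0 in_itv/= => /andP[nu0 nu1]; rewrite ger0_norm.
- move=> e e0; apply: filterS (unif_conv_nu_m T GmG e0) => m nu_close.
  apply: nearW => w; apply/rV_norm_leP => [|i]; first exact: ltW.
  by rewrite !mxE; exact: nu_close.
Qed.

Lemma cvg_wasserstein1_xhat_m :
  wasserstein1 P (block n x 0) (block n (xhat_m (@Gm m) (@Hm m) x) 0) @[m --> \oo] --> 0%E.
Proof.
have [_ [mxhat [xhat_x H_cont]]] := innovations.
have [C H_bnd] := continuous_seq_bounded_on_compact (@compact_unit_cube R) H_cont.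
have mxhat_block := random_vector_block 0 mxhat; have mx_block := random_vector_block 0 mx.
have same_blocks : same_law P (block n (causal H (causal G x)) 0) (block n x 0).
  exact: xhat_x.
under eq_cvg do rewrite -(same_law_wasserstein1 _ (mxhat_block n) (mx_block n) same_blocks).
have nu_cube := iid_uniform_unit_cube 0 iid_nu.
apply: (@cvg_wasserstein1_unif _ _ _ _ _ _ _ `|C|).
- move=> m; apply: random_vector_block; rewrite xhat_mE.
  by do 2 apply: rv_process_nu_m => //.
- exact: random_vector_block.
- apply: filterS nu_cube => w nu01; apply/rV_norm_leP => // i; rewrite mxE.
  exact: le_trans (H_bnd _ (nu01 i)) (ler_norm C).
- move=> e e0.
  have := unif_conv_xhat_m T (@compact_unit_cube R) H_cont GmG HmH e0.
  apply: filterS => m xhat_close; apply: filterS nu_cube => w nu01.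
  apply/rV_norm_leP => [|i]; first exact: ltW.
  by rewrite !mxE; apply: xhat_close; exact: nu01.
Qed.

Lemma cvg_loss_feasible (lam : R) : 0 < lam ->
  loss P lam (uvec n U) x (@Gm m) (@Hm m) @[m --> \oo] --> 0%E.
Proof.
move=> lam0; apply/loss_cvg0P => //; split.
- exact: cvg_wasserstein1_nu_m.
- exact: cvg_wasserstein1_xhat_m.
Qed.

End feasible_networks.

Section vanishing_loss.
Variables (d : measure_display) (T : measurableType d) (R : realType).
Variables (P : probability T R) (lam : R) (n : nat).
Variables (u : T -> 'rV[R]_n) (x : int -> T -> R) (Gm Hm : forall m : nat, 'rV[R]_m -> R).
Hypotheses (lam_gt0 : 0 < lam) (mu : random_vector u) (stationary_x : stationary P x).
Hypotheses (bGm : forall m, borel_fun (@Gm m)) (bHm : forall m, borel_fun (@Hm m)).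
Hypothesis loss_cvg0 : loss P lam u x (@Gm m) (@Hm m) @[m --> \oo] --> 0%E.

Let stationary_nu m : stationary P (nu_m (@Gm m) x).
Proof. exact: stationary_nu_m. Qed.

Let stationary_xhat m : stationary P (xhat_m (@Gm m) (@Hm m) x).
Proof. by rewrite xhat_mE; exact: stationary_nu_m. Qed.

Lemma conv_dist_nu_m t (nu : T -> 'rV[R]_n) : random_vector nu -> same_law P u nu ->
  conv_dist P (fun m => block n (nu_m (@Gm m) x) t) nu.
Proof.
move=> mnu same_u_nu.
have mnu_m m s : random_vector (block n (nu_m (@Gm m) x) s).
  exact: random_vector_block (stationary_nu m).1.
have [W_nu0 _] := (loss_cvg0P P u x lam_gt0 Gm Hm).1 loss_cvg0.
apply: conv_dist_same_law same_u_nu (conv_dist_wasserstein1 _ _ W_nu0) => // m.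
exact: stationary_block (stationary_nu m).
Qed.

Lemma conv_dist_xhat_m t :
  conv_dist P (fun m => block n (xhat_m (@Gm m) (@Hm m) x) t) (block n x t).
Proof.
have mx s : random_vector (block n x s) by exact: random_vector_block stationary_x.1.
have mxhat_m m s : random_vector (block n (xhat_m (@Gm m) (@Hm m) x) s).
  exact: random_vector_block (stationary_xhat m).1.
have same_x : same_law P (block n x 0) (block n x t) by exact: stationary_block.
have [_ W_x0] := (loss_cvg0P P u x lam_gt0 Gm Hm).1 loss_cvg0.
apply: conv_dist_same_law same_x (conv_dist_wasserstein1 _ _ W_x0) => // m.
exact: stationary_block (stationary_xhat m).
Qed.

End vanishing_loss.

Theorem theorem1 (d : measure_display) (T : measurableType d) (R : realType)
    (P : probability T R) (x : int -> T -> R) (lam : R)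
    (U : nat -> T -> R)
    (Theta Eta : nat -> Type)
    (Gnet : forall m : nat, Theta m -> 'rV[R]_m -> R)
    (Hnet : forall m : nat, Eta m -> 'rV[R]_m -> R)
    (G H : (nat -> R) -> R)
    (theta_star : nat -> forall m : nat, Theta m)
    (eta_star : nat -> forall m : nat, Eta m) :
  stationary P x ->
  0 < lam ->
  (* u^(n) := (U_0, ..., U_{n-1}) : i.i.d. U[0,1] variables *)
  iid_uniform P U ->
  (* the parameterized maps are (Borel) measurable *)
  (forall (m : nat) (th : Theta m), borel_fun (Gnet m th)) ->
  (forall (m : nat) (et : Eta m), borel_fun (Hnet m et)) ->
  (* (A1) existence of a weak innovations representation, H continuous *)
  weak_innovations P x G H ->
  (* (A2) feasibility *)
  (exists (th : forall m : nat, Theta m) (et : forall m : nat, Eta m),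
      unif_conv (fun m => Gnet m (th m)) G /\ unif_conv (fun m => Hnet m (et m)) H) ->
  (* (A3) training: (theta_star n m, eta_star n m) globally minimizes L^(n)_m *)
  (forall (n m : nat) (th : Theta m) (et : Eta m),
      (loss P lam (uvec n U) x (Gnet m (theta_star n m)) (Hnet m (eta_star n m))
       <= loss P lam (uvec n U) x (Gnet m th) (Hnet m et))%E) ->
  forall n : nat, (0 < n)%N -> forall t : int,
    conv_dist P (fun m => block n (nu_m (Gnet m (theta_star n m)) x) t)
                (block n (causal G x) t) /\
    conv_dist P (fun m => block n (xhat_m (Gnet m (theta_star n m))
                                          (Hnet m (eta_star n m)) x) t)
                (block n x t).
Proof.
move=> stationary_x lam0 iidU bG bH innovations [th [et [GmG HmH]]] optimal n _ t.
have [mx _] := stationary_x; have [iid_nu _] := innovations.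
have mu : random_vector (uvec n U) := random_vector_uvec iidU.
have loss_cvg0 : loss P lam (uvec n U) x (Gnet m (theta_star n m)) (Hnet m (eta_star n m))
    @[m --> \oo] --> 0%E.
  have feasible_cvg0 := cvg_loss_feasible n mx iidU (fun m => bG m (th m))
    (fun m => bH m (et m)) innovations GmG HmH lam0.
  apply: squeeze_cvge feasible_cvg0; last exact: cvg_cst.
  by apply: nearW => m; rewrite loss_ge0 ?optimal.
have bG_star m := bG m (theta_star n m); have bH_star m := bH m (eta_star n m).
split; last exact: (conv_dist_xhat_m lam0 stationary_x bG_star bH_star loss_cvg0).
apply: (conv_dist_nu_m lam0 mu stationary_x bG_star loss_cvg0).
- by apply: random_vector_block; case: iid_nu => -[].
- exact: same_law_uvec_block.
Qed.
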